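(* Let $\mu_Y\in\mathbb{R}$, $\sigma_Y>0$, $n\ge 2$, and let $X_1,\dots,X_n$ be i.i.d. with $X_i\sim LN(\mu_Y,\sigma_Y^2)$. Let $A_n=\frac1n\sum_{i=1}^n X_i$, $H_n=n\big/\sum_{i=1}^n (1/X_i)$, $K_n=\frac{A_n}{H_n}-1$, and $k=C_v^2=\exp(\sigma_Y^2)-1$. Then $$\operatorname{Var}(K_n)=\frac{2(n-1)}{n^2}\,k^2\left(1+k+\frac{k^2}{2n}\right)=\frac{2(n-1)}{n^2}\,C_v^4\left(1+C_v^2+\frac{C_v^4}{2n}\right),$$ and consequently $$\operatorname{sd}(K_n)=\frac{k}{n}\sqrt{2(n-1)\left(1+k+\frac{k^2}{2n}\right)}.$$
   Context: $X\sim LN(\mu_Y,\sigma_Y^2)$ means $\ln X\sim N(\mu_Y,\sigma_Y^2)$. For such $X$, $C_v=\sqrt{\operatorname{Var}(X)}/E[X]$ is the coefficient of variation and $k=E[X]\,E[1/X]-1$; one has $k=C_v^2=\exp(\sigma_Y^2)-1$. $\operatorname{sd}$ denotes the standard deviation (square root of the variance). *)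

(* Defs.v *)
(* No probability library is installed, so
   expectations w.r.t. i.i.d. lognormal variables are defined concretely as
   (iterated) improper Riemann integrals against the normal density in
   log-space:  X_i = exp(Y_i),  Y_i ~ N(mu, s^2) i.i.d. *)
From Stdlib Require Import Reals.
Open Scope R_scope.

Definition normal_pdf (mu s y : R) : R :=
  exp (- (y - mu) ^ 2 / (2 * s ^ 2)) / (s * sqrt (2 * PI)).

Definition improper_int_R (f : R -> R) (l : R) : Prop :=
  (forall a b, inhabited (Riemann_integrable f a b)) /\
  forall eps, 0 < eps -> exists A, forall a b (pr : Riemann_integrable f a b),
    a <= - A -> A <= b -> Rabs (RiemannInt pr - l) < eps.

Definition vcons (a : R) (x : nat -> R) : nat -> R :=
  fun i => match i with O => a | S j => x j end.

(* LN_expect n mu s g l  :<->  for X_1..X_n i.i.d. LN(mu, s^2) (stored at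
   indices 0..n-1 of the vector), E[g(X)] exists and equals l, computed as
   the iterated integral over the product of the n normal densities. *)
Fixpoint LN_expect (n : nat) (mu s : R) (g : (nat -> R) -> R) (l : R) : Prop :=
  match n with
  | O => g (fun _ => 0) = l
  | S m => exists h : R -> R,
      (forall y, LN_expect m mu s (fun x => g (vcons (exp y) x)) (h y)) /\
      improper_int_R (fun y => h y * normal_pdf mu s y) l
  end.

Definition arith_mean (n : nat) (x : nat -> R) : R :=
  sum_f_R0 (fun i => x i) (n - 1) / INR n.
Definition harm_mean (n : nat) (x : nat -> R) : R :=
  INR n / sum_f_R0 (fun i => / x i) (n - 1).
Definition K_stat (n : nat) (x : nat -> R) : R :=
  arith_mean n x / harm_mean n x - 1.

(* Main.v *)
(* With S = sum X_i and T = sum 1/X_i, K_n = S T / n^2 - 1, so the first two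
   moments of K_n are linear in E[S T] and E[S^2 T^2].  Expanding S^p T^q
   binomially in the first sample and using independence reduces these to the
   lognormal moments E[X^c] = exp (c mu + c^2 s^2 / 2), which are Gaussian
   integrals after completing the square.  The Gaussian integral comes from the
   classical fact that (int_0^x e^(-t^2) dt)^2 + int_0^1 e^(-x^2 (1+t^2)) / (1+t^2) dt
   has derivative 0.  In the final moments of K_n, E[X] and E[1/X] only occur
   through their product exp (s^2) = 1 + k. *)

Require Import Defs.
From Stdlib Require Import Reals Lra Psatz FunctionalExtensionality.
From Coquelicot Require Import Coquelicot.
Open Scope R_scope.
Set Bullet Behavior "Strict Subproofs".

Definition gauss (t : R) : R := exp (- t ^ 2).

Lemma continuous_gauss x : continuous gauss x.
Proof. apply (ex_derive_continuous (V := R_NormedModule)). unfold gauss. auto_derive. auto. Qed.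

Lemma ex_RInt_gauss a b : ex_RInt gauss a b.
Proof. apply (ex_RInt_continuous (V := R_CompleteNormedModule)). intros; apply continuous_gauss. Qed.

Definition gauss_int (x : R) : R := RInt gauss 0 x.

Lemma is_derive_gauss_int x : is_derive gauss_int x (gauss x).
Proof.
  apply (is_derive_RInt gauss gauss_int 0 x).
  - apply filter_forall. intro b. apply (RInt_correct (V := R_CompleteNormedModule)). apply ex_RInt_gauss.
  - apply continuous_gauss.
Qed.

Lemma gauss_int_ge0 x : 0 <= x -> 0 <= gauss_int x.
Proof. intros Hx. apply RInt_ge_0; auto. apply ex_RInt_gauss. intros; left; apply exp_pos. Qed.

Lemma gauss_int_opp x : gauss_int (- x) = - gauss_int x.
Proof.
  unfold gauss_int.
  replace (RInt gauss 0 (- x)) with (RInt gauss (-1 * 0 + 0) (-1 * x + 0)) by (f_equal; ring).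
  rewrite <- (RInt_comp_lin (V := R_CompleteNormedModule)) by apply ex_RInt_gauss.
  rewrite (RInt_ext _ (fun y => scal (-1) (gauss y))).
  2:{ intros y _. unfold gauss. f_equal. f_equal. f_equal. ring. }
  rewrite (RInt_scal (V := R_CompleteNormedModule)) by apply ex_RInt_gauss.
  unfold scal; simpl. unfold mult; simpl. ring.
Qed.

Lemma gauss_le_inv x : gauss x <= / (1 + x ^ 2).
Proof.
  unfold gauss. rewrite exp_Ropp. apply Rinv_le_contravar, exp_ineq1_le. nra.
Qed.

Definition gauss_aux_integrand (x t : R) : R := exp (- (x ^ 2 * (1 + t ^ 2))) / (1 + t ^ 2).

Definition gauss_aux (x : R) : R := RInt (gauss_aux_integrand x) 0 1.

Lemma continuous_gauss_aux_integrand x t : continuous (gauss_aux_integrand x) t.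
Proof.
  apply (ex_derive_continuous (V := R_NormedModule)).
  unfold gauss_aux_integrand. auto_derive. nra.
Qed.

Lemma ex_RInt_gauss_aux_integrand x : ex_RInt (gauss_aux_integrand x) 0 1.
Proof.
  apply (ex_RInt_continuous (V := R_CompleteNormedModule)).
  intros; apply continuous_gauss_aux_integrand.
Qed.

Definition gauss_aux_integrand_dx (x t : R) : R := - 2 * x * exp (- (x ^ 2 * (1 + t ^ 2))).

Lemma is_derive_gauss_aux_integrand x t :
  is_derive (fun z => gauss_aux_integrand z t) x (gauss_aux_integrand_dx x t).
Proof.
  unfold gauss_aux_integrand, gauss_aux_integrand_dx. auto_derive.
  - auto.
  - replace (x * (x * 1) * (1 + t * (t * 1))) with (x ^ 2 * (1 + t ^ 2)) by ring.
    field. nra.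
Qed.

Lemma continuity_2d_gauss_aux_integrand_dx x t : continuity_2d_pt gauss_aux_integrand_dx x t.
Proof.
  unfold gauss_aux_integrand_dx.
  apply continuity_2d_pt_mult.
  - apply continuity_2d_pt_mult. apply continuity_2d_pt_const. apply continuity_2d_pt_id1.
  - apply continuity_1d_2d_pt_comp with (f := exp) (g := fun u v => - (u ^ 2 * (1 + v ^ 2))).
    + apply derivable_continuous_pt, derivable_pt_exp.
    + apply continuity_2d_pt_opp; simpl.
      repeat first
        [ apply continuity_2d_pt_mult | apply continuity_2d_pt_plus
        | apply continuity_2d_pt_id1 | apply continuity_2d_pt_id2 | apply continuity_2d_pt_const ].
Qed.

Lemma RInt_gauss_aux_integrand_dx x :
  RInt (gauss_aux_integrand_dx x) 0 1 = - 2 * gauss x * gauss_int x.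
Proof.
  transitivity (RInt (fun t => scal (- 2 * gauss x) (scal x (gauss (x * t + 0)))) 0 1).
  { apply RInt_ext. intros t _. unfold gauss_aux_integrand_dx, gauss, scal; simpl. unfold mult; simpl.
    replace (exp (- (x * (x * 1) * (1 + t * (t * 1)))))
      with (exp (- (x * (x * 1))) * exp (- ((x * t + 0) * ((x * t + 0) * 1))))
      by (rewrite <- exp_plus; f_equal; ring).
    ring. }
  rewrite (RInt_scal (V := R_CompleteNormedModule)).
  2:{ apply (ex_RInt_continuous (V := R_CompleteNormedModule)). intros z _.
      apply (ex_derive_continuous (V := R_NormedModule)).
      unfold gauss, scal; simpl. unfold mult; simpl. auto_derive. auto. }
  rewrite (RInt_comp_lin (V := R_CompleteNormedModule)) by apply ex_RInt_gauss.
  unfold gauss_int. replace (x * 0 + 0) with 0 by ring. replace (x * 1 + 0) with x by ring.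
  reflexivity.
Qed.

Lemma is_derive_gauss_aux x : is_derive gauss_aux x (- 2 * gauss x * gauss_int x).
Proof.
  rewrite <- RInt_gauss_aux_integrand_dx.
  replace (RInt (gauss_aux_integrand_dx x) 0 1)
    with (RInt (fun t => Derive (fun z => gauss_aux_integrand z t) x) 0 1).
  2:{ apply RInt_ext. intros t _. apply is_derive_unique, is_derive_gauss_aux_integrand. }
  apply (is_derive_RInt_param gauss_aux_integrand 0 1 x).
  - apply filter_forall. intros y t _. eexists. apply is_derive_gauss_aux_integrand.
  - intros t _. eapply continuity_2d_pt_ext. 2: apply continuity_2d_gauss_aux_integrand_dx.
    intros; symmetry; apply is_derive_unique, is_derive_gauss_aux_integrand.
  - apply filter_forall. intro y. apply ex_RInt_gauss_aux_integrand.
Qed.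

Lemma gauss_aux0 : gauss_aux 0 = PI / 4.
Proof.
  unfold gauss_aux.
  rewrite (RInt_ext _ (fun t => / (1 + t ^ 2))).
  2:{ intros t _. unfold gauss_aux_integrand.
      replace (- (0 ^ 2 * (1 + t ^ 2))) with 0 by ring. rewrite exp_0. lra. }
  apply (is_RInt_unique (V := R_CompleteNormedModule)).
  replace (PI / 4) with (minus (atan 1) (atan 0)).
  2:{ rewrite atan_1, atan_0. unfold minus, plus, opp; simpl. ring. }
  apply (is_RInt_derive (V := R_CompleteNormedModule)).
  - intros z _. apply is_derive_Reals, derivable_pt_lim_atan.
  - intros z _. apply (ex_derive_continuous (V := R_NormedModule)). auto_derive. nra.
Qed.

Lemma gauss_aux_add_sqr x : 0 <= x -> gauss_aux x + gauss_int x ^ 2 = PI / 4.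
Proof.
  set (h z := gauss_aux z + gauss_int z ^ 2).
  assert (Hh : forall z, is_derive h z 0).
  { intro z.
    assert (H := is_derive_plus _ _ z _ _ (is_derive_gauss_aux z)
                   (is_derive_pow _ 2 z _ (is_derive_gauss_int z))).
    replace 0 with (plus (- 2 * gauss z * gauss_int z) (INR 2 * gauss z * gauss_int z ^ pred 2))
      by (simpl; unfold plus; simpl; ring).
    exact H. }
  assert (H0 : h 0 = PI / 4).
  { unfold h, gauss_int. rewrite RInt_point, gauss_aux0. simpl. unfold zero; simpl. ring. }
  intros [Hx|<-]; [|exact H0].
  rewrite <- H0. symmetry. apply (eq_is_derive h 0 x); auto.
Qed.

Lemma gauss_aux_ge0 x : 0 <= gauss_aux x.
Proof.
  apply RInt_ge_0. lra. apply ex_RInt_gauss_aux_integrand.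
  intros t _. unfold gauss_aux_integrand. apply Rlt_le, Rdiv_lt_0_compat. apply exp_pos. nra.
Qed.

Lemma gauss_aux_le_gauss x : gauss_aux x <= gauss x.
Proof.
  unfold gauss_aux. replace (gauss x) with (RInt (fun _ => gauss x) 0 1).
  2:{ rewrite (RInt_const (V := R_CompleteNormedModule)). unfold scal; simpl. unfold mult; simpl. ring. }
  apply RInt_le. lra. apply ex_RInt_gauss_aux_integrand. apply ex_RInt_const.
  intros t _. unfold gauss_aux_integrand, gauss.
  assert (Hexp : exp (- (x ^ 2 * (1 + t ^ 2))) <= exp (- x ^ 2)).
  { destruct (Req_dec (x ^ 2 * t ^ 2) 0) as [E|E].
    - right. f_equal. nra.
    - left. apply exp_increasing. assert (0 <= x ^ 2 * t ^ 2) by nra. lra. }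
  assert (Hinv : / (1 + t ^ 2) <= 1).
  { rewrite <- Rinv_1. apply Rinv_le_contravar; nra. }
  assert (0 < exp (- (x ^ 2 * (1 + t ^ 2)))) by apply exp_pos.
  unfold Rdiv. nra.
Qed.

Lemma gauss_int_dist x : 0 <= x -> Rabs (gauss_int x - sqrt PI / 2) <= 2 / sqrt PI * / (1 + x ^ 2).
Proof.
  intros Hx.
  assert (Hp : 0 < sqrt PI) by apply sqrt_lt_R0, PI_RGT_0.
  assert (Hs : sqrt PI * sqrt PI = PI) by (apply sqrt_sqrt; left; apply PI_RGT_0).
  assert (HG := gauss_int_ge0 x Hx). assert (Hsq := gauss_aux_add_sqr x Hx).
  assert (H0 := gauss_aux_ge0 x). assert (H1 := gauss_aux_le_gauss x).
  assert (H2 := gauss_le_inv x).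
  assert (E : gauss_int x - sqrt PI / 2 = - gauss_aux x / (gauss_int x + sqrt PI / 2)).
  { field_simplify_eq; nra. }
  rewrite E. unfold Rdiv. rewrite Rabs_mult, Rabs_Ropp, Rabs_inv.
  rewrite (Rabs_right (gauss_aux x)), (Rabs_right (gauss_int x + sqrt PI * / 2)) by lra.
  apply Rle_trans with (gauss_aux x * / (sqrt PI * / 2)).
  - apply Rmult_le_compat_l. lra. apply Rinv_le_contravar; lra.
  - replace (2 * / sqrt PI * / (1 + x ^ 2)) with (/ (1 + x ^ 2) * / (sqrt PI * / 2))
      by (field; split; apply Rgt_not_eq; nra).
    apply Rmult_le_compat_r. left; apply Rinv_0_lt_compat; lra. lra.
Qed.

Lemma gauss_int_tail eps : 0 < eps ->
  exists Z, forall z, Z <= z -> Rabs (gauss_int z - sqrt PI / 2) < eps.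
Proof.
  intros Heps.
  assert (Hp : 0 < sqrt PI) by apply sqrt_lt_R0, PI_RGT_0.
  set (Z := 2 / (sqrt PI * eps)).
  assert (HZ : 0 < Z) by (apply Rdiv_lt_0_compat; nra).
  exists Z. intros z Hz.
  eapply Rle_lt_trans. apply gauss_int_dist. lra.
  apply Rlt_le_trans with (2 / sqrt PI * / Z).
  - apply Rmult_lt_compat_l. apply Rdiv_lt_0_compat; lra.
    apply Rinv_lt_contravar; nra.
  - right. unfold Z. field. split; apply Rgt_not_eq; lra.
Qed.

Lemma improper_int_ext f g l : (forall y, f y = g y) -> improper_int_R f l -> improper_int_R g l.
Proof. intros E H. replace g with f; auto. apply functional_extensionality; auto. Qed.

Lemma improper_int_antiderivative f F lm lp :
  (forall y, continuous f y) -> (forall y, is_derive F y (f y)) ->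
  (forall eps, 0 < eps -> exists A, forall y, A <= y ->
     Rabs (F y - lp) < eps /\ Rabs (F (- y) - lm) < eps) ->
  improper_int_R f (lp - lm).
Proof.
  intros Hc HF Hlim.
  assert (Hex : forall a b, ex_RInt f a b)
    by (intros; apply (ex_RInt_continuous (V := R_CompleteNormedModule)); auto).
  split.
  { intros a b. constructor. apply ex_RInt_Reals_0, Hex. }
  intros eps Heps.
  destruct (Hlim (eps / 2)) as [A HA]. lra.
  exists A. intros a b pr Ha Hb.
  assert (Hab : RiemannInt pr = F b - F a).
  { rewrite <- RInt_Reals. apply (is_RInt_unique (V := R_CompleteNormedModule)).
    apply (is_RInt_derive (V := R_CompleteNormedModule)); auto. }
  destruct (HA b Hb) as [Hb' _]. destruct (HA (- a)) as [_ Ha']. lra.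
  rewrite Ropp_involutive in Ha'.
  rewrite Hab. replace (F b - F a - (lp - lm)) with ((F b - lp) - (F a - lm)) by ring.
  eapply Rle_lt_trans. apply Rabs_triang. rewrite Rabs_Ropp. lra.
Qed.

Lemma improper_int_lin f1 f2 l1 l2 c : improper_int_R f1 l1 -> improper_int_R f2 l2 ->
  improper_int_R (fun y => f1 y + c * f2 y) (l1 + c * l2).
Proof.
  intros [I1 H1] [I2 H2]. split.
  { intros a b. destruct (I1 a b) as [p1], (I2 a b) as [p2].
    constructor. apply RiemannInt_P10; auto. }
  intros eps Heps.
  assert (Hc : 0 <= Rabs c) by apply Rabs_pos.
  set (eps' := eps / (2 * (Rabs c + 1))).
  assert (Heps' : 0 < eps') by (apply Rdiv_lt_0_compat; lra).
  assert (Hceps : Rabs c * eps' <= eps / 2).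
  { unfold eps'. apply Rmult_le_reg_r with (2 * (Rabs c + 1)). lra.
    field_simplify; [nra | lra]. }
  destruct (H1 eps' Heps') as [A1 HA1], (H2 eps' Heps') as [A2 HA2].
  exists (Rmax A1 A2). intros a b pr Ha Hb.
  assert (HA1' := Rmax_l A1 A2). assert (HA2' := Rmax_r A1 A2).
  destruct (I1 a b) as [p1], (I2 a b) as [p2].
  rewrite (RiemannInt_P13 p1 p2 pr).
  assert (E1 := HA1 a b p1 ltac:(lra) ltac:(lra)).
  assert (E2 := HA2 a b p2 ltac:(lra) ltac:(lra)).
  replace (RiemannInt p1 + c * RiemannInt p2 - (l1 + c * l2))
    with ((RiemannInt p1 - l1) + c * (RiemannInt p2 - l2)) by ring.
  eapply Rle_lt_trans. apply Rabs_triang. rewrite Rabs_mult.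
  assert (Rabs c * Rabs (RiemannInt p2 - l2) <= Rabs c * eps') by (apply Rmult_le_compat_l; lra).
  assert (eps' <= eps / 2).
  { unfold eps'. apply Rmult_le_compat_l. lra. apply Rinv_le_contravar; lra. }
  lra.
Qed.

Lemma improper_int_scal f l c : improper_int_R f l -> improper_int_R (fun y => c * f y) (c * l).
Proof.
  intros H. replace (c * l) with (l + (c - 1) * l) by ring.
  eapply improper_int_ext. 2: apply (improper_int_lin _ _ _ _ (c - 1) H H). intros; simpl; ring.
Qed.

Definition lognormal_moment (mu s c : R) : R := exp (c * mu + c ^ 2 * s ^ 2 / 2).

Lemma exp_mul_normal_pdf mu s c y : 0 < s ->
  exp (c * y) * normal_pdf mu s y =
  lognormal_moment mu s c / sqrt PI * (/ (s * sqrt 2) * gauss ((y - (mu + c * s ^ 2)) / (s * sqrt 2))).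
Proof.
  intros Hs.
  assert (Hp : 0 < sqrt PI) by apply sqrt_lt_R0, PI_RGT_0.
  assert (H2 : 0 < sqrt 2) by (apply sqrt_lt_R0; lra).
  assert (H22 : sqrt 2 ^ 2 = 2) by (simpl; rewrite Rmult_1_r; apply sqrt_sqrt; lra).
  assert (H2P : sqrt (2 * PI) = sqrt 2 * sqrt PI) by (apply sqrt_mult; lra || (left; apply PI_RGT_0)).
  unfold normal_pdf, lognormal_moment, gauss. rewrite H2P.
  replace (- ((y - (mu + c * s ^ 2)) / (s * sqrt 2)) ^ 2)
    with ((c * y + - (y - mu) ^ 2 / (2 * s ^ 2)) + - (c * mu + c ^ 2 * s ^ 2 / 2)).
  2:{ field_simplify_eq; [rewrite H22; ring | lra]. }
  rewrite (exp_plus (c * y + _)), exp_Ropp, (exp_plus (c * y)). field.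
  split; [apply Rgt_not_eq, exp_pos | split; lra].
Qed.

Lemma improper_int_exp_normal_pdf mu s c : 0 < s ->
  improper_int_R (fun y => exp (c * y) * normal_pdf mu s y) (lognormal_moment mu s c).
Proof.
  intros Hs.
  assert (Hp : 0 < sqrt PI) by apply sqrt_lt_R0, PI_RGT_0.
  assert (Hw : 0 < s * sqrt 2) by (apply Rmult_lt_0_compat; [lra | apply sqrt_lt_R0; lra]).
  set (K := lognormal_moment mu s c). assert (HK : 0 < K) by apply exp_pos.
  set (m := mu + c * s ^ 2). set (w := s * sqrt 2) in Hw.
  set (F y := K / sqrt PI * gauss_int ((y - m) / w)).
  assert (HF : forall z eps', Rabs (gauss_int z - sqrt PI / 2) < eps' ->
                 Rabs (K / sqrt PI * gauss_int z - K / 2) < K / sqrt PI * eps').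
  { intros z eps' Hz.
    replace (K / sqrt PI * gauss_int z - K / 2) with (K / sqrt PI * (gauss_int z - sqrt PI / 2))
      by (field; lra).
    rewrite Rabs_mult, Rabs_right by (apply Rle_ge, Rlt_le, Rdiv_lt_0_compat; lra).
    apply Rmult_lt_compat_l; [apply Rdiv_lt_0_compat |]; lra. }
  replace K with (K / 2 - - (K / 2)) by field.
  apply (improper_int_antiderivative _ F).
  - intro y. apply (ex_derive_continuous (V := R_NormedModule)).
    unfold normal_pdf. auto_derive. auto.
  - intro y. rewrite exp_mul_normal_pdf by exact Hs. fold K m w.
    apply (is_derive_scal (fun y => gauss_int ((y - m) / w))).
    apply (is_derive_comp gauss_int (fun y => (y - m) / w)).
    + apply is_derive_gauss_int.
    + auto_derive; auto. field. lra.
  - intros eps Heps.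
    destruct (gauss_int_tail (eps * sqrt PI / K)) as [Z HZ].
    { apply Rdiv_lt_0_compat; nra. }
    assert (Heps' : K / sqrt PI * (eps * sqrt PI / K) = eps) by (field; lra).
    assert (Hm := Rle_abs m). assert (Hm' := Rle_abs (- m)). rewrite Rabs_Ropp in Hm'.
    exists (Rabs m + w * Z). intros y Hy. split.
    + rewrite <- Heps'. apply HF, HZ.
      apply Rmult_le_reg_r with w; [lra |]. field_simplify; lra.
    + replace (F (- y) - - (K / 2)) with (- (K / sqrt PI * gauss_int ((y + m) / w) - K / 2)).
      2:{ unfold F. replace ((- y - m) / w) with (- ((y + m) / w)) by (field; lra).
          rewrite gauss_int_opp. ring. }
      rewrite Rabs_Ropp, <- Heps'. apply HF, HZ.
      apply Rmult_le_reg_r with w; [lra |]. field_simplify; lra.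
Qed.

Section LognormalExpectation.
Variables mu s : R.

Lemma LN_expect_ext n g g' l l' :
  (forall x, g x = g' x) -> l = l' -> LN_expect n mu s g l -> LN_expect n mu s g' l'.
Proof. intros E <- H. replace g' with g; auto. apply functional_extensionality; auto. Qed.

(* The samples are of the form [exp y], so only positive vectors matter. *)
Lemma LN_expect_ext_pos n : forall g g' l,
  (forall x, (forall i, (i < n)%nat -> 0 < x i) -> g x = g' x) ->
  LN_expect n mu s g l -> LN_expect n mu s g' l.
Proof.
  induction n as [|m IH]; intros g g' l E H; simpl in *.
  - rewrite <- E; auto. intros; lia.
  - destruct H as [h [Hh Hi]]. exists h. split; auto.
    intro y. apply (IH (fun x => g (vcons (exp y) x))); auto.
    intros x Hx. apply E. intros [|i] Hi'; simpl.
    + apply exp_pos.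
    + apply Hx. lia.
Qed.

Lemma LN_expect_lin n : forall g1 g2 l1 l2 c,
  LN_expect n mu s g1 l1 -> LN_expect n mu s g2 l2 ->
  LN_expect n mu s (fun x => g1 x + c * g2 x) (l1 + c * l2).
Proof.
  induction n as [|m IH]; intros g1 g2 l1 l2 c H1 H2; simpl in *.
  - subst; auto.
  - destruct H1 as [h1 [Hh1 Hi1]], H2 as [h2 [Hh2 Hi2]].
    exists (fun y => h1 y + c * h2 y). split.
    + intro y. apply (IH (fun x => g1 (vcons (exp y) x)) (fun x => g2 (vcons (exp y) x))); auto.
    + eapply improper_int_ext. 2: apply (improper_int_lin _ _ _ _ c Hi1 Hi2).
      intros; simpl; ring.
Qed.

Lemma LN_expect_scal n g l c :
  LN_expect n mu s g l -> LN_expect n mu s (fun x => c * g x) (c * l).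
Proof.
  intros H. eapply LN_expect_ext. 3: apply (LN_expect_lin _ _ _ _ _ (c - 1) H H).
  all: intros; simpl; ring.
Qed.

Lemma LN_expect_sum n (F : nat -> (nat -> R) -> R) (L : nat -> R) N :
  (forall i, (i <= N)%nat -> LN_expect n mu s (F i) (L i)) ->
  LN_expect n mu s (fun x => sum_f_R0 (fun i => F i x) N) (sum_f_R0 L N).
Proof.
  induction N as [|N IH]; intros H; simpl.
  - apply H. lia.
  - eapply LN_expect_ext. 3: eapply (LN_expect_lin _ _ _ _ _ 1).
    3: apply IH; intros; apply H; lia.
    3: apply (H (S N)); lia.
    all: intros; simpl; ring.
Qed.

Lemma LN_expect_S_mul m phi psi a l :
  improper_int_R (fun y => phi (exp y) * normal_pdf mu s y) a ->
  LN_expect m mu s psi l ->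
  LN_expect (S m) mu s (fun x => phi (x O) * psi (fun i => x (S i))) (a * l).
Proof.
  intros I H. simpl. exists (fun y => phi (exp y) * l). split.
  - intro y. apply LN_expect_scal. exact H.
  - rewrite Rmult_comm. eapply improper_int_ext. 2: apply (improper_int_scal _ _ l I).
    intros; simpl; ring.
Qed.

End LognormalExpectation.

Fixpoint vsum (n : nat) (x : nat -> R) : R :=
  match n with O => 0 | S m => x O + vsum m (fun i => x (S i)) end.

Lemma vsum_Sr n : forall x, vsum (S n) x = vsum n x + x n.
Proof.
  induction n as [|n IH]; intro x.
  - simpl. ring.
  - change (vsum (S (S n)) x) with (x O + vsum (S n) (fun i => x (S i))).
    rewrite IH. simpl. ring.
Qed.

Lemma sum_f_R0_vsum n x : sum_f_R0 x n = vsum (S n) x.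
Proof.
  induction n as [|n IH]; simpl sum_f_R0.
  - simpl. ring.
  - rewrite IH, (vsum_Sr (S n)). reflexivity.
Qed.

Lemma vsum_pos n : forall x, (0 < n)%nat -> (forall i, (i < n)%nat -> 0 < x i) -> 0 < vsum n x.
Proof.
  induction n as [|[|n] IH]; intros x Hn Hx; [lia | |]; simpl.
  - assert (0 < x O) by (apply Hx; lia). lra.
  - assert (0 < x O) by (apply Hx; lia).
    assert (0 < vsum (S n) (fun i => x (S i))) by (apply IH; [lia | intros; apply Hx; lia]).
    simpl in *. lra.
Qed.

Lemma exp_pow y i : exp y ^ i = exp (INR i * y).
Proof.
  induction i as [|i IH].
  - simpl. rewrite Rmult_0_l, exp_0. reflexivity.
  - rewrite S_INR. simpl. rewrite IH, <- exp_plus. f_equal. ring.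
Qed.

Section JointMoments.
Variables mu s : R.
Hypothesis s_pos : 0 < s.

Lemma improper_int_pow_normal_pdf (i j : nat) :
  improper_int_R (fun y => (exp y ^ i * (/ exp y) ^ j) * normal_pdf mu s y)
    (lognormal_moment mu s (INR i - INR j)).
Proof.
  eapply improper_int_ext. 2: apply (improper_int_exp_normal_pdf mu s _ s_pos).
  intro y. simpl. rewrite pow_inv, !exp_pow, <- exp_Ropp, <- exp_plus.
  f_equal. f_equal. ring.
Qed.

(* [joint_moment n p q = E[S^p T^q]] with [S = sum X_i], [T = sum 1/X_i] over
   [n] samples; the recursion is the binomial expansion in the first sample. *)
Fixpoint joint_moment (n p q : nat) : R :=
  match n with
  | O => match p, q with O, O => 1 | _, _ => 0 end
  | S m => sum_f_R0 (fun i => sum_f_R0 (fun j =>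
             Binomial.C p i * Binomial.C q j * lognormal_moment mu s (INR i - INR j)
             * joint_moment m (p - i) (q - j)) q) p
  end.

Lemma LN_expect_joint_moment n : forall p q,
  LN_expect n mu s (fun x => vsum n x ^ p * vsum n (fun i => / x i) ^ q) (joint_moment n p q).
Proof.
  induction n as [|m IH]; intros p q.
  - simpl. destruct p, q; simpl; ring.
  - set (term i j (x : nat -> R) :=
           (Binomial.C p i * Binomial.C q j * x O ^ i * (/ x O) ^ j)
           * (vsum m (fun k => x (S k)) ^ (p - i) * vsum m (fun k => / x (S k)) ^ (q - j))).
    eapply LN_expect_ext.
    3:{ apply LN_expect_sum with (F := fun i x => sum_f_R0 (fun j => term i j x) q).
        intros i _. apply LN_expect_sum. intros j _.
        apply (LN_expect_S_mul mu s m (fun e => Binomial.C p i * Binomial.C q j * e ^ i * (/ e) ^ j)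
                 (fun x => vsum m x ^ (p - i) * vsum m (fun k => / x k) ^ (q - j))).
        - eapply improper_int_ext. 2: apply (improper_int_scal _ _ (Binomial.C p i * Binomial.C q j)
                           (improper_int_pow_normal_pdf i j)).
          intro y. simpl. ring.
        - apply IH. }
    + intro x. cbn [vsum]. rewrite !binomial, (Rmult_comm (sum_f_R0 _ p)), scal_sum.
      apply sum_eq. intros i _.
      rewrite scal_sum. apply sum_eq. intros j _. unfold term. ring.
    + reflexivity.
Qed.
End JointMoments.

Section ClosedForms.
Variables mu s : R.
Local Notation al := (lognormal_moment mu s 1).
Local Notation be := (lognormal_moment mu s (-1)).

Lemma lognormal_moment_pow (a b : nat) c : c = INR a - INR b -> c ^ 2 = INR a + INR b ->
  lognormal_moment mu s c = al ^ a * be ^ b.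
Proof.
  intros Hc Hc2. unfold lognormal_moment. rewrite !exp_pow, <- exp_plus.
  f_equal. rewrite Hc2, Hc. field.
Qed.

Lemma lognormal_moment_opp : be = exp (s ^ 2) / al.
Proof.
  unfold lognormal_moment.
  replace (-1 * mu + (-1) ^ 2 * s ^ 2 / 2) with (s ^ 2 + - (1 * mu + 1 ^ 2 * s ^ 2 / 2)) by field.
  rewrite exp_plus, exp_Ropp. reflexivity.
Qed.

Lemma joint_moment_closed n : let N := INR n in
  joint_moment mu s n 0 0 = 1 /\
  joint_moment mu s n 0 1 = N * be /\
  joint_moment mu s n 0 2 = (N^2 - N) * be^2 + N * al * be^3 /\
  joint_moment mu s n 1 0 = N * al /\
  joint_moment mu s n 1 1 = N + (N^2 - N) * al * be /\
  joint_moment mu s n 1 2 = (2*N^2 - N) * be + (N^3 - 3*N^2 + 2*N) * al * be^2 + (N^2 - N) * al^2 * be^3 /\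
  joint_moment mu s n 2 0 = (N^2 - N) * al^2 + N * al^3 * be /\
  joint_moment mu s n 2 1 = (2*N^2 - N) * al + (N^3 - 3*N^2 + 2*N) * al^2 * be + (N^2 - N) * al^3 * be^2 /\
  joint_moment mu s n 2 2 = (2*N^2 - N) + (4*N^3 - 8*N^2 + 4*N) * al * be
       + (N^4 - 6*N^3 + 11*N^2 - 6*N) * al^2 * be^2 + (2*N^3 - 6*N^2 + 4*N) * al^3 * be^3
       + (N^2 - N) * al^4 * be^4.
Proof.
  induction n as [|m IH]; intro N; subst N.
  - simpl. repeat split; ring.
  - rewrite S_INR. destruct IH as (H00 & H01 & H02 & H10 & H11 & H12 & H20 & H21 & H22).
    cbn [joint_moment sum_f_R0 Nat.sub].
    rewrite H00, H01, H02, H10, H11, H12, H20, H21, H22.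
    rewrite (lognormal_moment_pow 0 0 (INR 0 - INR 0)), (lognormal_moment_pow 0 0 (INR 1 - INR 1)),
      (lognormal_moment_pow 0 0 (INR 2 - INR 2)), (lognormal_moment_pow 1 0 (INR 1 - INR 0)),
      (lognormal_moment_pow 1 0 (INR 2 - INR 1)), (lognormal_moment_pow 0 1 (INR 0 - INR 1)),
      (lognormal_moment_pow 0 1 (INR 1 - INR 2)), (lognormal_moment_pow 3 1 (INR 2 - INR 0)),
      (lognormal_moment_pow 1 3 (INR 0 - INR 2)) by (simpl; ring).
    unfold Binomial.C. simpl.
    repeat split; field.
Qed.
End ClosedForms.

Lemma K_stat_vsum n x : (0 < n)%nat -> (forall i, (i < n)%nat -> 0 < x i) ->
  K_stat n x = vsum n x * vsum n (fun i => / x i) / INR n ^ 2 - 1.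
Proof.
  intros Hn Hx.
  assert (HT : 0 < vsum n (fun i => / x i))
    by (apply vsum_pos; auto; intros; apply Rinv_0_lt_compat; auto).
  assert (HN : 0 < INR n) by (apply lt_0_INR; lia).
  unfold K_stat, arith_mean, harm_mean.
  destruct n as [|n]; [lia |].
  replace (S n - 1)%nat with n by lia.
  rewrite !sum_f_R0_vsum. change (fun i => x i) with x. field. split; lra.
Qed.

Definition K_mean (n : nat) (s : R) : R := (INR n - 1) * (exp (s ^ 2) - 1) / INR n.

Definition K_variance (n : nat) (s : R) : R :=
  let k := exp (s ^ 2) - 1 in
  2 * (INR n - 1) / INR n ^ 2 * k ^ 2 * (1 + k + k ^ 2 / (2 * INR n)).

Section KStatMoments.
Variables (mu s : R) (n : nat).
Hypotheses (s_pos : 0 < s) (n_pos : (0 < n)%nat).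

Lemma LN_expect_K_stat_quadratic a b c :
  LN_expect n mu s (fun x => a * K_stat n x ^ 2 + b * K_stat n x + c)
    (a * (K_variance n s + K_mean n s ^ 2) + b * K_mean n s + c).
Proof.
  assert (HN : INR n <> 0) by (apply not_0_INR; lia).
  assert (Hal : lognormal_moment mu s 1 <> 0) by apply Rgt_not_eq, exp_pos.
  pose proof (LN_expect_joint_moment mu s s_pos n) as HJ.
  destruct (joint_moment_closed mu s n) as (H00 & _ & _ & _ & H11 & _ & _ & _ & H22).
  replace (a * (K_variance n s + K_mean n s ^ 2) + b * K_mean n s + c) with
    (a / INR n ^ 4 * joint_moment mu s n 2 2 + (b - 2 * a) / INR n ^ 2 * joint_moment mu s n 1 1
     + (a - b + c) * joint_moment mu s n 0 0).
  2:{ rewrite H00, H11, H22, lognormal_moment_opp. unfold K_variance, K_mean. field. auto. }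
  eapply LN_expect_ext_pos.
  2:{ apply LN_expect_lin; [apply LN_expect_lin; [apply LN_expect_scal |] |]; apply HJ. }
  intros x Hx. rewrite K_stat_vsum by auto. simpl. field. auto.
Qed.
End KStatMoments.

Theorem proposition3 (mu s : R) (n : nat) :
  0 < s -> (2 <= n)%nat ->
  let k := exp (s ^ 2) - 1 in
  let V := 2 * (INR n - 1) / INR n ^ 2 * k ^ 2 * (1 + k + k ^ 2 / (2 * INR n)) in
  exists m : R,
    LN_expect n mu s (K_stat n) m /\
    LN_expect n mu s (fun x => (K_stat n x - m) ^ 2) V /\
    V = 2 * (INR n - 1) / INR n ^ 2 * (sqrt k) ^ 4
          * (1 + (sqrt k) ^ 2 + (sqrt k) ^ 4 / (2 * INR n)) /\
    sqrt V = k / INR n * sqrt (2 * (INR n - 1) * (1 + k + k ^ 2 / (2 * INR n))).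
Proof.
  intros Hs Hn k V.
  assert (HN : 2 <= INR n) by (apply (le_INR 2); auto).
  assert (Hk : 0 <= k) by (pose proof (exp_ineq1_le (s ^ 2)); pose proof (pow2_ge_0 s); unfold k; lra).
  assert (Hsqrtk : sqrt k ^ 2 = k) by (rewrite <- Rsqr_pow2; apply Rsqr_sqrt, Hk).
  assert (Hn0 : (0 < n)%nat) by lia.
  exists (K_mean n s). split; [|split; [|split]].
  - eapply LN_expect_ext. 3: apply (LN_expect_K_stat_quadratic mu s n Hs Hn0 0 1 0).
    all: intros; cbv beta; ring.
  - eapply LN_expect_ext.
    3: apply (LN_expect_K_stat_quadratic mu s n Hs Hn0 1 (- 2 * K_mean n s) (K_mean n s ^ 2)).
    all: intros; cbv beta; unfold V, K_variance; fold k; ring.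
  - replace (sqrt k ^ 4) with ((sqrt k ^ 2) ^ 2) by ring. rewrite Hsqrtk. reflexivity.
  - replace V with ((k / INR n) ^ 2 * (2 * (INR n - 1) * (1 + k + k ^ 2 / (2 * INR n))))
      by (unfold V; field; lra).
    assert (0 <= k / INR n) by (apply Rdiv_le_0_compat; lra).
    assert (0 <= k ^ 2 / (2 * INR n)) by (apply Rdiv_le_0_compat; [apply pow2_ge_0 | lra]).
    rewrite sqrt_mult, sqrt_pow2 by (auto using pow2_ge_0 with real; nra). reflexivity.
Qed.
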